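(* Every ideal in an interval order contains a cofinal chain; that is, if $I$ is an ideal of an interval order $P$, there is a chain $L\subseteq I$ such that every element of $I$ is below or equal to some element of $L$.
   Context: A poset is an interval order if it is isomorphic to a set of nonempty intervals of some chain, ordered by $I<J$ iff $x<y$ for all $x\in I$, $y\in J$. An initial segment of a poset $P$ is a subset $I$ such that $x\in I$ and $y\le x$ imply $y\in I$. An ideal is a nonempty initial segment which is up-directed (any two elements of it have a common upper bound in it). *)

(* Defs.v *)
From HB Require Import structures.
From mathcomp Require Import all_boot all_order.
From mathcomp Require Import boolp classical_sets functions.

Set Implicit Arguments.
Unset Strict Implicit.
Unset Printing Implicit Defensive.

Import Order.TTheory.
Local Open Scope order_scope.
Local Open Scope classical_set_scope.

(* Intervals of an arbitrary chain are its convex subsets: they need not have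
   endpoints in the chain. *)
Definition is_interval (d : Order.disp_t) (C : orderType d) (A : set C) : Prop :=
  forall x y : C, A x -> A y -> forall z : C, x <= z <= y -> A z.

Definition interval_lt (d : Order.disp_t) (C : orderType d) (A B : set C) : Prop :=
  forall x y : C, A x -> B y -> x < y.

Definition is_interval_order (d : Order.disp_t) (P : porderType d) : Prop :=
  exists (d' : Order.disp_t) (C : orderType d') (S : set (set C)) (f : P -> set C),
    [/\ forall A, S A -> A !=set0 /\ is_interval A,
        set_bij [set: P] S f &
        forall x y : P, x < y <-> interval_lt (f x) (f y)].

Definition initial_segment (d : Order.disp_t) (P : porderType d) (I : set P) : Prop :=
  forall x y : P, I x -> y <= x -> I y.

Definition up_directed (d : Order.disp_t) (P : porderType d) (I : set P) : Prop :=
  forall x y : P, I x -> I y -> exists z, [/\ I z, x <= z & y <= z].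

Definition is_ideal (d : Order.disp_t) (P : porderType d) (I : set P) : Prop :=
  [/\ I !=set0, initial_segment I & up_directed I].

(* Main.v *)
(** Any maximal chain [L] of the ideal [I] is cofinal. Interval orders are
    (2+2)-free. If [x] in [I] is not below any element of [L], then [x] is not
    the maximum of [I] (else [L] could be extended by [x]), so [x < z] for some
    [z] in [I]. Each [y] in [L] is below some [y'] in [L] strictly (else [y]
    would be maximal in [I], hence its maximum), and (2+2)-freeness for [y < y']
    and [x < z] gives [y < z]. So [L] can be extended by [z], contradicting
    maximality. *)
Require Import Defs.
From mathcomp Require Import all_boot all_order.
From mathcomp Require Import boolp classical_sets functions.

Import Order.TTheory.
Local Open Scope order_scope.
Local Open Scope classical_set_scope.

(** If both alternatives fail, there are [b <= a] with [a] in [f x], [b] in [f v], and [e <= c] with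
    [c] in [f u], [e] in [f y]; then [a < e <= c < b <= a]. *)
Lemma interval_order_2p2_free (d : Order.disp_t) (P : porderType d) :
  is_interval_order P ->
  forall x y u v : P, x < y -> u < v -> x < v \/ u < y.
Proof.
move=> [d' [C [S [f [_ _ ltE]]]]] x y u v /ltE xy /ltE uv.
apply: contrapT => /not_orP[nxv nuy].
apply: nxv; apply/ltE => a b xa vb; rewrite ltNge; apply/negP => ba.
apply: nuy; apply/ltE => c e uc ye; rewrite ltNge; apply/negP => ec.
have ae := xy _ _ xa ye; have cb := uv _ _ uc vb.
by have := lt_le_trans (lt_trans (lt_le_trans ae ec) cb) ba; rewrite ltxx.
Qed.

(** Zorn's lemma on the chains inside [I]; maximality is recorded in the one-point form used
    later. *)
Lemma exists_maximal_chain (d : Order.disp_t) (P : porderType d) (I : set P) :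
  exists L : set P,
    [/\ L `<=` I,
        total_on L (fun x y : P => x <= y) &
        forall x : P, I x -> (forall y : P, L y -> y <= x \/ x <= y) -> L x].
Proof.
pose chain (L : set P) := L `<=` I /\ total_on L (fun x y : P => x <= y).
have [F Fchain Ftot|L [[LI Ltot] Lmax]] := @Zorn_bigcup P chain.
  split=> [x [A FA Ax]|x y [A FA Ax] [B FB By]].
    exact: (Fchain _ FA).1.
  have [AB|BA] := Ftot _ _ FA FB.
    by apply: (Fchain _ FB).2 => //; exact: AB.
  by apply: (Fchain _ FA).2 => //; exact: BA.
exists L; split=> // x Ix cmpx; apply: contrapT => nLx.
apply: (Lmax (x |` L)).
  by split=> [y Ly|/(_ x (or_introl erefl))//]; right.
split=> [y [->//|/LI//]|y z [->|Ly] [->|Lz]].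
- by left.
- by have [] := cmpx _ Lz; [right|left].
- by have [] := cmpx _ Ly; [left|right].
- exact: Ltot.
Qed.

(** A common upper bound of [m] and [x] in [I] cannot exceed [m] strictly, so it is [m]. *)
Lemma up_directed_maximal_max (d : Order.disp_t) (P : porderType d) (I : set P)
    (m : P) :
  up_directed I -> I m -> (forall y : P, I y -> ~ m < y) ->
  forall x : P, I x -> x <= m.
Proof.
move=> Idir Im mmax x Ix; have [z [Iz mz xz]] := Idir _ _ Im Ix.
by move: mz; rewrite le_eqVlt => /orP[/eqP->//|/(mmax _ Iz)].
Qed.

Theorem theorem5p3 (d : Order.disp_t) (P : porderType d) (I : set P) :
  is_interval_order P -> is_ideal I ->
  exists L : set P,
    [/\ L `<=` I,
        total_on L (fun x y : P => x <= y) &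
        forall x : P, I x -> exists2 y : P, L y & x <= y].
Proof.
move=> /interval_order_2p2_free free [_ _ Idir].
have [L [LI Ltot Lmax]] := exists_maximal_chain _ _ I.
exists L; split=> // x Ix; apply: contrapT => nx.
have nLx y : L y -> ~ x <= y by move=> Ly xy; apply: nx; exists y.
have [[z [Iz xz]]|xmax] := pselect (exists z, I z /\ x < z); last first.
  have xtop : forall y, I y -> y <= x.
    by apply: up_directed_maximal_max => // y Iy xy; apply: xmax; exists y.
  by apply: (nLx x) => //; apply: Lmax => // y /LI /xtop; left.
apply: (nLx z); last exact: ltW.
apply: (Lmax z) => // y Ly; left.
have [[y' [Ly' yy']]|ymax] := pselect (exists y', L y' /\ y < y').
  by have [/ltW//|/ltW/(nLx _ Ly')] := free _ _ _ _ yy' xz.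
case: (nLx y) => //; apply: (up_directed_maximal_max _ _ _ _ Idir) => //.
  exact: LI.
(* Here [y] is the top of [L], so any [w > y] in [I] is above all of [L] and hence lies in [L],
   contradicting [ymax]. *)
move=> w Iw yw; apply: (ymax); exists w; split=> //; apply: Lmax => // u Lu; left.
have [uy|] := Ltot _ _ Lu Ly; first exact: le_trans uy (ltW yw).
rewrite le_eqVlt => /orP[/eqP<-|yu]; first exact: ltW.
by case: ymax; exists u.
Qed.
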